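(* Let $R=\Bbbk[h^{\pm1}](\sigma,a)$ be a quantum generalized Weyl algebra with parameter $q$ and $a(h)=(h-c_1)(h-c_2)\cdots(h-c_{N_a})$. Let $\gamma,\mu\in\Bbbk^\times$ with $\mathrm{ord}(\gamma)=n<\infty$, $\mathrm{ord}(\mu)=m<\infty$, $n\mid i_0$ and $\gcd(n,m)=1$, and let $\eta=\eta_{\gamma,\mu}\in\mathrm{Aut}(R)$. Then $R^{\langle\eta\rangle}$ is simple if and only if $R$ is simple.
   Context: $\Bbbk$ is a field and all algebras are associative $\Bbbk$-algebras. For a commutative algebra $D$, $\sigma\in\mathrm{Aut}(D)$ and $0\neq a\in D$, the generalized Weyl algebra (GWA) $D(\sigma,a)$ is generated over $D$ by $x,y$ subject to $xd=\sigma(d)x$, $yd=\sigma^{-1}(d)y$ ($d\in D$), $yx=a$, $xy=\sigma(a)$. Here $D=\Bbbk[h^{\pm1}]$, and quantum means $\sigma(h)=qh$ with $q\in\Bbbk\setminus\{0,1\}$. The polynomial $a(h)$ is monic of positive degree, splits into linear factors over $\Bbbk$ with all $c_i\neq0$, and $N_a$ is its number of roots counted with multiplicity. Write $a=\sum_{i\in I}a_ih^i$ with $I$ the set of $i$ with $a_i\neq0$, $g=\gcd\{i-j: a_ia_j\neq0\}$, and let $C_g$ be the group of $g$th roots of unity in $\Bbbk$. Fix $i_0\in I$. For $\gamma\in C_g$ and $\mu\in\Bbbk^\times$, $\eta_{\gamma,\mu}$ is the automorphism of $R$ with $\eta_{\gamma,\mu}(h)=\gamma h$, $\eta_{\gamma,\mu}(y)=y\mu$,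 $\eta_{\gamma,\mu}(x)=\mu^{-1}\gamma^{i_0}x$ (independent of the choice of $i_0$); writing $\eta_{\gamma,\mu}$ presupposes $\gamma\in C_g$. $\mathrm{ord}$ denotes multiplicative order in $\Bbbk^\times$, and $R^{\langle\eta\rangle}$ is the subring of elements fixed by $\eta$. *)

(* Defs.v *)
From HB Require Import structures.
From mathcomp Require Import all_boot all_order all_algebra.

Set Implicit Arguments.
Unset Strict Implicit.
Unset Printing Implicit Defensive.

Import GRing.Theory.
Local Open Scope ring_scope.

Record two_sided_ideal (R : nzRingType) (I : R -> Prop) : Prop := TwoSidedIdeal {
  ideal0 : I 0;
  idealB : forall u v, I u -> I v -> I (u - v);
  idealMl : forall r u, I u -> I (r * u);
  idealMr : forall r u, I u -> I (u * r)
}.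

(* An nzRingType satisfies 1 <> 0, so R is never the zero ring here. *)
Definition simple_ring (R : nzRingType) : Prop :=
  forall I : R -> Prop, two_sided_ideal I ->
    (forall u, I u -> u = 0) \/ (forall u, I u).

Section FixedRing.
Variables (R : nzRingType) (f : {rmorphism R -> R}).

Definition fixed : {pred R} := [pred u | f u == u].

Fact fixed_subring_closed : subring_closed fixed.
Proof.
split=> [|u v|u v]; rewrite !inE ?rmorph1 //.
  by move=> /eqP fu /eqP fv; rewrite rmorphB fu fv.
by move=> /eqP fu /eqP fv; rewrite rmorphM fu fv.
Qed.

HB.instance Definition _ :=
  GRing.isSubringClosed.Build R fixed fixed_subring_closed.

Record fixed_ring := FixedRing { fixed_val : R; _ : fixed_val \in fixed }.

HB.instance Definition _ := [isSub for fixed_val].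
HB.instance Definition _ := [Choice of fixed_ring by <:].
HB.instance Definition _ := [SubChoice_isSubNzRing of fixed_ring by <:].

End FixedRing.

(* D is k[h^{+-1}], the localization of k[h] at the powers of h.
   Note that [horner_alg h p] is p(h). *)
Record is_laurent (k : fieldType) (D : comUnitAlgType k) (h : D) : Prop :=
  IsLaurent {
    laurent_unit : h \is a GRing.unit;
    laurent_inj : injective (horner_alg h);
    laurent_gen : forall d : D,
      exists (n : nat) (p : {poly k}), d = h ^- n * horner_alg h p
  }.

Section GWA.
Variables (k : fieldType) (D : comAlgType k).
Variables (sigma sigmaV : D -> D) (a : D).

Record gwa_rel (A : algType k) (f : D -> A) (x y : A) : Prop := GwaRel {
  gwa_xd : forall d, x * f d = f (sigma d) * x;
  gwa_yd : forall d, y * f d = f (sigmaV d) * y;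
  gwa_yx : y * x = f a;
  gwa_xy : x * y = f (sigma a)
}.

(* R, with the structure map iota and the elements x and y, is the k-algebra
   generated over D by x and y subject to the relations gwa_rel: the relations
   hold in R, and R is initial among the algebras over D with this property.
   The maps sigma and sigmaV are meant to be inverse automorphisms of D. *)
Record is_gwa (R : algType k) (iota : {lrmorphism D -> R}) (x y : R) : Prop :=
  IsGwa {
    gwa_neq0 : a != 0;
    gwa_relP : gwa_rel iota x y;
    gwa_lift : forall (A : algType k) (f : {lrmorphism D -> A}) (x' y' : A),
      gwa_rel f x' y' ->
      exists phi : {lrmorphism R -> A},
        [/\ forall d, phi (iota d) = f d, phi x = x' & phi y = y'];
    gwa_uniq : forall (A : algType k) (phi psi : {lrmorphism R -> A}),
      (forall d, phi (iota d) = psi (iota d)) -> phi x = psi x ->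
      phi y = psi y -> phi =1 psi
  }.

End GWA.

(* gcd {i - j : a_i a_j <> 0}; the differences are taken up to sign. *)
Definition exponent_gcd (k : fieldType) (a : {poly k}) : nat :=
  \big[gcdn/0%N]_(i < size a) \big[gcdn/0%N]_(j < size a | a`_i * a`_j != 0)
    `|i%:Z - j%:Z|%N.

(* eta = eta_{gamma, mu}; here h, x and y are elements of R, and i0 is the
   exponent of a nonzero coefficient of the polynomial a. *)
Record is_eta (k : fieldType) (a : {poly k}) (R : algType k) (h x y : R)
    (i0 : nat) (gamma mu : k) (eta : R -> R) : Prop := IsEta {
  eta_gamma : gamma ^+ exponent_gcd a = 1;
  eta_bij : bijective eta;
  eta_h : eta h = gamma *: h;
  eta_y : eta y = mu *: y;
  eta_x : eta x = (mu^-1 * gamma ^+ i0) *: x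
}.

(* Main.v *)
Require Import Defs.
From HB Require Import structures.
From mathcomp Require Import all_boot all_order all_algebra.
From mathcomp Require Import boolp.

(* Both rings are simple exactly when c_i <> q^l c_j for all i, j and l > 0
   (i = j says that q is not a root of unity); this is shown for the fixed ring
   S of eta, and R itself is the case eta = id.

   If c_i = q^l c_j, split off the factor h - c_i of a to let R act on k[h, 1/h]
   by x = sigma (h - c_i) and y = (a / (h - c_i)) sigma^-1. The ideal spanned by
   f = (h - c_i / q) ... (h - c_i / q^l) is a submodule of finite codimension,
   and the elements of S sending everything into it form a proper ideal, nonzero
   because it contains a polynomial in h^n.

   Conversely, conjugation by h^n has distinct eigenvalues on the homogeneous
   components of R, so a nonzero ideal I of S contains a nonzero homogeneous
   element, hence a nonzero Laurent polynomial in h, hence some P(h^n) with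
   P(0) <> 0. For M a multiple of m, x^M P(h^n) y^M and y^M P(h^n) x^M are P with
   a rescaled argument times products of shifts of a; the former are coprime to P
   for a suitable M, the latter are coprime to each other, so 1 is in I. *)

Set Implicit Arguments.
Unset Strict Implicit.
Unset Printing Implicit Defensive.

Import GRing.Theory.
Local Open Scope ring_scope.

(** * The algebra of linear endomorphisms, target of the polynomial representation *)

Section EndomorphismAlgebra.
Variables (k : fieldType) (D : algType k).

(** Equality and choice on this type are classical; they help make it an [algType], as the universal
    property [gwa_lift] requires of its target. *)
Record endo := Endo { endo_fun : D -> D; _ : linear endo_fun }.

HB.instance Definition _ := gen_eqMixin endo.
HB.instance Definition _ := gen_choiceMixin endo.

Implicit Types u v w : endo.

Lemma endo_linear u : linear (endo_fun u). Proof. by case: u. Qed.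

HB.instance Definition _ u :=
  GRing.isLinear.Build k D D _ (endo_fun u) (endo_linear u).

Lemma endoP u v : endo_fun u =1 endo_fun v -> u = v.
Proof.
case: u v => [u ul] [v vl] /= /funext uv; case: _ / uv in vl *.
by congr Endo; apply: Prop_irrelevance.
Qed.

Fact endo_zero_subproof : linear (fun _ : D => 0 : D).
Proof. by move=> c u v; rewrite scaler0 addr0. Qed.
Fact endo_opp_subproof u : linear (fun d => - endo_fun u d).
Proof. by move=> c d e; rewrite linearP opprD scalerN. Qed.
Fact endo_add_subproof u v : linear (fun d => endo_fun u d + endo_fun v d).
Proof. by move=> c d e; rewrite !linearP scalerDr addrACA. Qed.
Fact endo_one_subproof : linear (fun d : D => d). Proof. by []. Qed.
Fact endo_mul_subproof u v : linear (fun d => endo_fun u (endo_fun v d)).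
Proof. by move=> c d e; rewrite !linearP. Qed.
Fact endo_scale_subproof c u : linear (fun d => c *: endo_fun u d).
Proof. by move=> b d e; rewrite linearP scalerDr !scalerA mulrC. Qed.

Definition endo_zero := Endo endo_zero_subproof.
Definition endo_opp u := Endo (endo_opp_subproof u).
Definition endo_add u v := Endo (endo_add_subproof u v).
Definition endo_one := Endo endo_one_subproof.
Definition endo_mul u v := Endo (endo_mul_subproof u v).
Definition endo_scale c u := Endo (endo_scale_subproof c u).

Fact endo_addA : associative endo_add.
Proof. by move=> u v w; apply: endoP => d; apply: addrA. Qed.
Fact endo_addC : commutative endo_add.
Proof. by move=> u v; apply: endoP => d; apply: addrC. Qed.
Fact endo_add0 : left_id endo_zero endo_add.
Proof. by move=> u; apply: endoP => d; apply: add0r. Qed.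
Fact endo_addN : left_inverse endo_zero endo_opp endo_add.
Proof. by move=> u; apply: endoP => d; apply: addNr. Qed.

HB.instance Definition _ :=
  GRing.isZmodule.Build endo endo_addA endo_addC endo_add0 endo_addN.

Fact endo_mulA : associative endo_mul.
Proof. by move=> u v w; apply: endoP. Qed.
Fact endo_mul1 : left_id endo_one endo_mul.
Proof. by move=> u; apply: endoP. Qed.
Fact endo_mulr1 : right_id endo_one endo_mul.
Proof. by move=> u; apply: endoP. Qed.
Fact endo_mulDl : left_distributive endo_mul +%R.
Proof. by move=> u v w; apply: endoP. Qed.
Fact endo_mulDr : right_distributive endo_mul +%R.
Proof. by move=> u v w; apply: endoP => d /=; rewrite linearD. Qed.
Fact endo_oner_neq0 : endo_one != 0.
Proof.
apply/eqP => /(congr1 (fun u => endo_fun u 1)) /eqP /=.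
by rewrite oner_eq0.
Qed.

HB.instance Definition _ := GRing.Zmodule_isNzRing.Build endo
  endo_mulA endo_mul1 endo_mulr1 endo_mulDl endo_mulDr endo_oner_neq0.

Fact endo_scaleA b c u : endo_scale b (endo_scale c u) = endo_scale (b * c) u.
Proof. by apply: endoP => d /=; rewrite scalerA. Qed.
Fact endo_scale1 : left_id 1 endo_scale.
Proof. by move=> u; apply: endoP => d; apply: scale1r. Qed.
Fact endo_scaleDr : right_distributive endo_scale +%R.
Proof. by move=> c u v; apply: endoP => d; apply: scalerDr. Qed.
Fact endo_scaleDl u : {morph endo_scale^~ u : b c / b + c}.
Proof. by move=> b c; apply: endoP => d; apply: scalerDl. Qed.

HB.instance Definition _ := GRing.Zmodule_isLmodule.Build k endo
  endo_scaleA endo_scale1 endo_scaleDr endo_scaleDl.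

Fact endo_scaleAl c u v : c *: (u * v) = c *: u * v.
Proof. by apply: endoP. Qed.
HB.instance Definition _ := GRing.Lmodule_isLalgebra.Build k endo endo_scaleAl.
Fact endo_scaleAr c u v : c *: (u * v) = u * (c *: v).
Proof. by apply: endoP => d; rewrite /= linearZ. Qed.
HB.instance Definition _ := GRing.Lalgebra_isAlgebra.Build k endo endo_scaleAr.

Fact lmul_subproof (d : D) : linear (fun e => d * e).
Proof. by move=> c e f; rewrite mulrDr scalerAr. Qed.
Definition lmul d : endo := Endo (lmul_subproof d).

Fact lmul_is_linear : linear lmul.
Proof.
by move=> c d e; apply: endoP => f; rewrite /= mulrDl -scalerAl.
Qed.
HB.instance Definition _ := GRing.isLinear.Build k D endo _ lmul lmul_is_linear.
Fact lmul_is_monoid_morphism : monoid_morphism lmul.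
Proof.
split; first by apply: endoP => f; rewrite /= mul1r.
by move=> d e; apply: endoP => f; rewrite /= mulrA.
Qed.
HB.instance Definition _ :=
  GRing.isMonoidMorphism.Build D endo lmul lmul_is_monoid_morphism.

End EndomorphismAlgebra.

(** * Induction on the generators of a generalized Weyl algebra *)

Section Generation.
Variables (k : fieldType) (D : comAlgType k) (sigma sigmaV : D -> D) (a : D).
Variables (R : algType k) (iota : {lrmorphism D -> R}) (x y : R).
Hypothesis gwa_R : is_gwa sigma sigmaV a iota x y.
Variable P : R -> Prop.
Hypotheses (Piota : forall d, P (iota d)) (Px : P x) (Py : P y).
Hypothesis PD : forall u v, P u -> P v -> P (u + v).
Hypothesis PM : forall u v, P u -> P v -> P (u * v).

Definition gen_pred : {pred R} := [pred u | `[< P u >]].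

Lemma gen_predP u : reflect (P u) (u \in gen_pred).
Proof. exact: asboolP. Qed.

Fact gen_pred_subalg : subalg_closed gen_pred.
Proof.
split; first by apply/gen_predP; rewrite -(rmorph1 iota); apply: Piota.
  move=> c u v /gen_predP Pu /gen_predP Pv; apply/gen_predP/PD => //.
  by rewrite -mulr_algl -(rmorph_alg iota); apply: PM.
by move=> u v /gen_predP Pu /gen_predP Pv; apply/gen_predP/PM.
Qed.

HB.instance Definition _ :=
  GRing.isSubalgClosed.Build k R gen_pred gen_pred_subalg.

Record gen_sub := GenSub { gen_val : R; _ : gen_val \in gen_pred }.
HB.instance Definition _ := [isSub for gen_val].
HB.instance Definition _ := [Choice of gen_sub by <:].
HB.instance Definition _ := [SubChoice_isSubAlgebra of gen_sub by <:].

Definition gen_iota (d : D) : gen_sub := GenSub (introT (gen_predP _) (Piota d)).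

Fact gen_iota_linear : linear gen_iota.
Proof. by move=> c d e; apply: val_inj; rewrite /= linearP. Qed.
Fact gen_iota_monoid_morphism : monoid_morphism gen_iota.
Proof.
by split=> [|d e]; apply: val_inj; rewrite /= ?rmorph1 ?rmorphM.
Qed.
HB.instance Definition _ :=
  GRing.isLinear.Build k D gen_sub _ gen_iota gen_iota_linear.
HB.instance Definition _ :=
  GRing.isMonoidMorphism.Build D gen_sub gen_iota gen_iota_monoid_morphism.

Fact gen_val_linear : linear gen_val. Proof. by []. Qed.
Fact gen_val_monoid_morphism : monoid_morphism gen_val. Proof. by []. Qed.
HB.instance Definition _ :=
  GRing.isLinear.Build k gen_sub R _ gen_val gen_val_linear.
HB.instance Definition _ :=
  GRing.isMonoidMorphism.Build gen_sub R gen_val gen_val_monoid_morphism.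

(** The elements satisfying [P] form a subalgebra containing the generators. Initiality maps [R]
    into it, and followed by the inclusion this map is the identity by [gwa_uniq]. *)
Lemma gwa_ind u : P u.
Proof.
pose x' : gen_sub := GenSub (introT (gen_predP _) Px).
pose y' : gen_sub := GenSub (introT (gen_predP _) Py).
have [xd yd yx xy] := gwa_relP gwa_R.
have rel : gwa_rel sigma sigmaV a (gen_iota : {lrmorphism D -> gen_sub}) x' y'.
  by split=> [d|d||]; apply: val_inj; rewrite /= ?xd ?yd ?yx ?xy.
have [phi [phi_iota phi_x phi_y]] := gwa_lift gwa_R rel.
pose psi : {lrmorphism R -> R} := gen_val \o phi.
have -> : u = psi u.
  apply: (gwa_uniq gwa_R (phi := idfun) (psi := psi)) => [d||] /=.
  - by rewrite phi_iota.
  - by rewrite phi_x.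
  - by rewrite phi_y.
exact/gen_predP/(valP (phi u)).
Qed.

End Generation.

(** * Polynomial representations and the spanning monomials *)

Section Representation.
Variables (k : fieldType) (D : comAlgType k).
Variables (sigma sigmaV : {lrmorphism D -> D}).
Hypotheses (sigmaK : cancel sigma sigmaV) (sigmaVK : cancel sigmaV sigma).
Variables (a : D) (R : algType k) (iota : {lrmorphism D -> R}) (x y : R).
Hypothesis gwa_R : is_gwa sigma sigmaV a iota x y.

(* For a factorization a = b b', the polynomial representation of R on D in
   which x acts as sigma b and y as b' sigma^-1. *)
Lemma gwa_rep b b' : b * b' = a -> exists phi : {lrmorphism R -> endo D},
  [/\ forall d e, endo_fun (phi (iota d)) e = d * e,
      forall e, endo_fun (phi x) e = sigma (b * e)
    & forall e, endo_fun (phi y) e = b' * sigmaV e].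
Proof.
move=> bb'.
have X_linear : linear (fun e => sigma (b * e)).
  by move=> c d e; rewrite mulrDr -scalerAr linearP.
have Y_linear : linear (fun e => b' * sigmaV e).
  by move=> c d e; rewrite linearP mulrDr -scalerAr.
have rel : gwa_rel sigma sigmaV a (lmul (D:=D)) (Endo X_linear) (Endo Y_linear).
  split=> [d|d||]; apply: endoP => e /=.
  - by rewrite mulrCA rmorphM.
  - by rewrite rmorphM mulrCA.
  - by rewrite sigmaK mulrA [b' * b]mulrC bb'.
  - by rewrite mulrA bb' rmorphM /= sigmaVK.
have [phi [phi_iota phi_x phi_y]] := gwa_lift gwa_R rel.
by exists phi; split=> [d e|e|e]; rewrite ?phi_iota ?phi_x ?phi_y.
Qed.

(** For the trivial factorization [a = 1 * a], the action of [iota d] sends 1 to [d]. *)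
Lemma gwa_iota_inj : injective iota.
Proof.
have [phi [phi_iota _ _]] := gwa_rep (mul1r a).
move=> d e /(congr1 (fun u => endo_fun (phi u) 1)).
by rewrite !phi_iota !mulr1.
Qed.

(** Adjacent [x] and [y] collapse to an element of [D], so the span of all [d x^i] and [d y^i] is
    stable under left multiplication by the generators. The extra factor [y] leaves degree 0 to the
    first summand alone. *)
Lemma gwa_span u : exists p e : {poly D},
  u = (map_poly iota p).[x] + (map_poly iota e).[y] * y.
Proof.
pose W u := exists p e : {poly D},
  u = (map_poly iota p).[x] + (map_poly iota e).[y] * y.
have WD v w : W v -> W w -> W (v + w).
  move=> [p [e ->]] [p' [e' ->]]; exists (p + p'), (e + e').
  by rewrite !rmorphD !hornerD mulrDl addrACA.
have Wx d i : W (iota d * x ^+ i).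
  exists (d *: 'X^i), 0; rewrite rmorph0 horner0 mul0r addr0.
  by rewrite map_polyZ map_polyXn /= hornerZ hornerXn.
have Wy d i : W (iota d * y ^+ i).
  case: i => [|i]; first by apply: (Wx d 0%N).
  exists 0, (d *: 'X^i); rewrite rmorph0 horner0 add0r.
  by rewrite map_polyZ map_polyXn /= hornerZ hornerXn exprSr mulrA.
have W_ind (Q : R -> Prop) : Q 0 -> (forall v w, Q v -> Q w -> Q (v + w)) ->
    (forall d i, Q (iota d * x ^+ i)) -> (forall d i, Q (iota d * y ^+ i)) ->
    forall w, W w -> Q w.
  move=> Q0 QD Qx Qy _ [p [e ->]].
  rewrite (horner_coef_wide _ (size_poly _ _)).
  rewrite [X in _ + X * y](horner_coef_wide _ (size_poly _ _)).
  rewrite mulr_suml; apply: (QD).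
    by apply: (big_ind Q Q0 QD) => i _; rewrite coef_map; apply: Qx.
  by apply: (big_ind Q Q0 QD) => i _; rewrite coef_map /= -mulrA -exprSr; apply: Qy.
have W0 : W 0 by exists 0, 0; rewrite rmorph0 !horner0 mul0r addr0.
have [xd yd yx xy] := gwa_relP gwa_R.
have WM v : forall w, W w -> W (v * w).
  move: v; apply: (gwa_ind gwa_R) => [d|||v v' Wv Wv' w Ww|v v' Wv Wv' w Ww].
  - apply: (W_ind) => [|v w Wv Ww|e i|e i].
    + by rewrite mulr0.
    + by rewrite mulrDr; apply: WD.
    + by rewrite mulrA -rmorphM; apply: Wx.
    + by rewrite mulrA -rmorphM; apply: Wy.
  - apply: (W_ind) => [|v w Wv Ww|e i|e [|i]].
    + by rewrite mulr0.
    + by rewrite mulrDr; apply: WD.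
    + by rewrite mulrA xd -mulrA -exprS; apply: Wx.
    + by rewrite mulr1 xd -[x]expr1; apply: Wx.
    + by rewrite mulrA xd -mulrA exprS [x * _]mulrA xy !mulrA -rmorphM; apply: Wy.
  - apply: (W_ind) => [|v w Wv Ww|e [|i]|e i].
    + by rewrite mulr0.
    + by rewrite mulrDr; apply: WD.
    + by rewrite mulr1 yd -[y]expr1; apply: Wy.
    + by rewrite mulrA yd -mulrA exprS [y * _]mulrA yx !mulrA -rmorphM; apply: Wx.
    + by rewrite mulrA yd -mulrA -exprS; apply: Wy.
  - by rewrite mulrDl; apply: WD; [apply: Wv | apply: Wv'].
  - by rewrite -mulrA; apply/Wv/Wv'.
rewrite -[u]mulr1; apply: WM; rewrite -[1]mulr1 -{1}(rmorph1 iota) -(expr0 x).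
exact: Wx.
Qed.

End Representation.

(** * Rescaling the variable of a polynomial *)

Section Dilation.
Variable k : fieldType.
Implicit Types (p q : {poly k}) (r s c : k).

(** The effect on p(h) of an automorphism scaling [h] by [r]; see [horner_alg_dilate]. *)
Definition dilate r p := p \Po (r *: 'X).

HB.instance Definition _ r := GRing.RMorphism.copy (dilate r)
  (comp_poly (r *: 'X)).

Lemma coef_dilate r p i : (dilate r p)`_i = r ^+ i * p`_i.
Proof.
rewrite /dilate; elim/poly_ind: p i => [|p c IH] i.
  by rewrite comp_poly0 coef0 mulr0.
rewrite comp_poly_MXaddC -scalerAr !coefD coefZ !coefMX !coefC.
by case: i => [|i] /=; rewrite ?mulr0 ?expr0 ?mul1r // IH addr0 addr0 mulrA exprS.
Qed.

Lemma dilateM r s p : dilate r (dilate s p) = dilate (r * s) p.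
Proof. by apply/polyP => i; rewrite !coef_dilate mulrA exprMn. Qed.

Lemma dilate1 p : dilate 1 p = p.
Proof. by apply/polyP => i; rewrite coef_dilate expr1n mul1r. Qed.

Lemma dilate_XsubC r c :
  r != 0 -> dilate r ('X - c%:P) = r *: ('X - (c / r)%:P).
Proof.
move=> r0; rewrite /dilate comp_polyB comp_polyX comp_polyC scalerBr.
by rewrite scale_polyC mulrC divfK.
Qed.

Lemma dilate_comp_Xn r n p :
  dilate r (p \Po 'X^n) = dilate (r ^+ n) p \Po 'X^n.
Proof.
by rewrite /dilate -!comp_polyA comp_polyZ comp_polyX comp_Xn_poly exprZn.
Qed.

Lemma dilate_eq0 r p : r != 0 -> (dilate r p == 0) = (p == 0).
Proof.
move=> r0; apply/eqP/eqP => [|->]; last exact: rmorph0.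
by move=> /(congr1 (dilate r^-1)); rewrite dilateM mulVf // dilate1 rmorph0.
Qed.

Lemma coprimep_dilate r p q :
  coprimep p q -> coprimep (dilate r p) (dilate r q).
Proof. exact: coprimep_comp_poly. Qed.

Lemma comp_Xn_of_support n p : (0 < n)%N ->
  (forall i, p`_i != 0 -> (n %| i)%N) -> exists q, p = q \Po 'X^n.
Proof.
move=> n0 pn; exists (\poly_(i < size p) p`_(i * n)); apply/polyP => i.
rewrite coef_comp_poly_Xn //; case: ifPn => [ndvd|]; last first.
  by apply: contraNeq => /pn.
rewrite coef_poly divnK //; case: ifPn => //; rewrite -leqNgt => le_pi.
by rewrite nth_default // (leq_trans le_pi) // leq_div.
Qed.

(** Coefficient [i] is multiplied by [c ^+ i], so it can be nonzero only when [n] divides [i]. *)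
Lemma comp_Xn_of_dilate n c p : n.-primitive_root c ->
  dilate c p = p -> exists q, p = q \Po 'X^n.
Proof.
move=> c_n cp; apply: (comp_Xn_of_support (prim_order_gt0 c_n)) => i pi0.
rewrite (prim_order_dvd c_n) -subr_eq0 -(mulIr_eq0 _ (mulIf pi0)).
by rewrite mulrBl mul1r -coef_dilate cp subrr.
Qed.

(** A common divisor d of [p] and [q] yields the common divisor d(X^n), of degree n deg d, which
    must be 0. *)
Lemma coprimep_comp_Xn n p q : (0 < n)%N ->
  coprimep (p \Po 'X^n) (q \Po 'X^n) -> coprimep p q.
Proof.
move=> n0 /coprimepP cpq; apply/coprimepP => d dp dq.
have := cpq _ (dvdp_comp_poly 'X^n dp) (dvdp_comp_poly 'X^n dq).
rewrite -!size_poly_eq1 => /eqP sd.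
have d0 : d != 0 by apply: contra_eq_neq sd => ->; rewrite comp_poly0 size_poly0.
have := size_comp_poly d 'X^n; rewrite sd size_polyXn /= => /esym /eqP.
by rewrite muln_eq0 (gtn_eqF n0) orbF -subn1 subn_eq0 eqn_leq lt0n
  size_poly_eq0 d0 andbT.
Qed.

Lemma coprimep_prodl (I : Type) (s : seq I) (F : I -> {poly k}) q :
  (forall i, coprimep (F i) q) -> coprimep (\prod_(i <- s) F i) q.
Proof.
move=> Fq; elim/big_ind: _ => [|u v|i _];
  by rewrite ?coprime1p ?coprimepMl // => -> ->.
Qed.

Lemma coprimep_prodr (I : Type) (s : seq I) (F : I -> {poly k}) q :
  (forall i, coprimep q (F i)) -> coprimep q (\prod_(i <- s) F i).
Proof.
by move=> Fq; rewrite coprimep_sym coprimep_prodl // => i; rewrite coprimep_sym.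
Qed.

Lemma expr_inj r : r != 0 -> (forall l, (0 < l)%N -> r ^+ l != 1) ->
  injective (fun l => r ^+ l).
Proof.
move=> r0 r_inf i j; wlog lij : i j / (i <= j)%N.
  by move=> H; case: (leqP i j) => [|/ltnW] /H // {}H /esym/H ->.
rewrite -{1}(subnKC lij) exprD -[LHS]mulr1 => /(mulfI (expf_neq0 _ r0)) /esym.
have [/eqP|/r_inf/eqP //] := posnP (j - i).
by rewrite subn_eq0 => lji _; apply/eqP; rewrite eqn_leq lij.
Qed.

(* The resultant of p(sX) and p(X) is a nonzero polynomial in s, so it does
   not vanish at all the powers of r. *)
Lemma coprimep_dilate_expr p r : p.[0] != 0 -> r != 0 ->
  (forall l, (0 < l)%N -> r ^+ l != 1) ->
  exists l, coprimep p (dilate (r ^+ l) p).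
Proof.
move=> p0 r0 r_inf.
have nz_p : p != 0 by apply: contraNneq p0 => ->; rewrite horner0.
(* Constants are treated apart because [resultant_in_ideal] needs positive degree. *)
have [p1|p_gt1] := leqP (size p) 1.
  exists 0%N; rewrite expr0 dilate1.
  have := nz_p; rewrite -size_poly_gt0 => p_gt0.
  have : size p == 1%N by rewrite eqn_leq p1 p_gt0.
  by rewrite size_poly_eq1 => /eqp_coprimepl ->; rewrite coprime1p.
have E0 := div_annihilant_neq0 nz_p p0.
set E := div_annihilant p p in E0.
have [l El] : exists l, E.[r ^+ l] != 0.
  have [/allP Er|] := boolP (all (root E) [seq r ^+ l | l <- iota 0 (size E)]);
    last by rewrite -has_predC => /hasP [_ /mapP [l _ ->]] El; exists l.
  suff r_uniq : uniq [seq r ^+ l | l <- iota 0 (size E)].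
    have := max_poly_roots E0 (introT allP Er) r_uniq.
    by rewrite size_map size_iota ltnn.
  by rewrite map_inj_uniq ?iota_uniq //; apply: expr_inj.
exists l; apply/Bezout_coprimepP.
have sX : (1 < size (poly_XmY p))%N by rewrite size_poly_XmY.
have sC : (1 < size p^:P)%N by rewrite size_map_polyC.
(* The resultant is a combination of p(sX) and p(X); specializing s to [r ^+ l] gives a Bezout
   relation whose value is the nonzero constant [E.[r ^+ l]]. *)
have [[u v] /= _ /(congr1 (map_poly (horner_eval (r ^+ l))))] :=
  resultant_in_ideal sX sC.
rewrite rmorphD !rmorphM /= map_polyC /= -/(div_annihilant p p) -/E.
rewrite -[map_poly _ p^:P]map_poly_comp.
rewrite [map_poly (_ \o _) p]map_poly_id; last first.
  by move=> c _; rewrite /= /horner_eval hornerC.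
rewrite /poly_XmY map_comp_poly -map_poly_comp.
rewrite [map_poly (_ \o _) p]map_poly_id; last first.
  by move=> c _; rewrite /= /horner_eval hornerC.
rewrite rmorphM /= map_polyX map_polyC /= /horner_eval hornerX.
rewrite [X in _ \Po X]mulrC mul_polyC -/(dilate _ _) => Euv.
exists (map_poly (horner_eval (r ^+ l)) v, map_poly (horner_eval (r ^+ l)) u).
rewrite addrC /= -Euv -size_poly_eq1 size_polyC.
by rewrite El.
Qed.

End Dilation.

(** * Simplicity of a subring, phrased inside the ambient ring *)

Record sub_ideal (R : nzRingType) (S : {pred R}) (I : R -> Prop) : Prop :=
  SubIdeal {
    sub_idealW : forall u, I u -> u \in S;
    sub_ideal0 : I 0;
    sub_idealB : forall u v, I u -> I v -> I (u - v);
    sub_idealMl : forall r u, r \in S -> I u -> I (r * u);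
    sub_idealMr : forall r u, r \in S -> I u -> I (u * r)
  }.

(** With predicates on [R] in place of a subtype, the fixed ring and [R] itself, fixed by the
    identity, fall under one criterion. *)
Definition simple_sub (R : nzRingType) (S : {pred R}) : Prop :=
  forall I, sub_ideal S I ->
    (forall u, I u -> u = 0) \/ (forall u, u \in S -> I u).

Lemma simple_fixed_ring (R : nzRingType) (f : {rmorphism R -> R}) :
  simple_ring (fixed_ring f) <-> simple_sub (fixed f).
Proof.
split=> [simpleF I [IS I0 IB IMl IMr]|simpleS J [J0 JB JMl JMr]].
  have [] := simpleF (fun v => I (fixed_val v)).
  - split=> //= [u v|[r Sr] u|[r Sr] u]; first exact: IB.
      exact: IMl.
    exact: IMr.
  - move=> I_0; left=> u Iu.
    by have /(congr1 (@fixed_val _ _)) := I_0 (FixedRing (IS _ Iu)) Iu.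
  - by move=> I_1; right=> u Su; apply: (I_1 (FixedRing Su)).
have [] := simpleS (fun u => exists2 v : fixed_ring f, J v & fixed_val v = u).
- split=> [_ [[v Sv] _ <-] //||_ _ [u Ju <-] [v Jv <-]|r _ Sr [u Ju <-]
           |r _ Sr [u Ju <-]].
  + by exists 0.
  + by exists (u - v); first exact: JB.
  + by exists (FixedRing Sr * u); first exact: JMl.
  + by exists (u * FixedRing Sr); first exact: JMr.
- move=> J_0; left=> u Ju; apply: val_inj; apply: J_0.
  by exists u.
- move=> J_1; right=> u; have [v Jv vu] := J_1 _ (valP u).
  by rewrite -(val_inj vu).
Qed.

Lemma simple_ring_fixed_id (R : nzRingType) :
  simple_ring R <-> simple_sub (fixed (idfun : {rmorphism R -> R})).
Proof.
have S1 u : u \in fixed (idfun : {rmorphism R -> R}) by rewrite inE /=.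
split=> [simpleR I [_ I0 IB IMl IMr]|simpleS I [I0 IB IMl IMr]].
  have I_ideal : two_sided_ideal I.
    by split=> // r u; [apply: IMl | apply: IMr].
  by have [I_0|I_1] := simpleR I I_ideal; [left | right].
have I_ideal : sub_ideal (fixed (idfun : {rmorphism R -> R})) I.
  by split=> // r u _; [apply: IMl | apply: IMr].
have [I_0|I_1] := simpleS I I_ideal; first by left.
by right=> u; apply: I_1.
Qed.

(* Applying T - lam j0 to a sum of eigenvectors of T removes its j0 component. *)
Lemma eigen_components (k : fieldType) (A : algType k) (T : endo A)
    (I : A -> Prop) (J : eqType) (lam : J -> k) (s : seq J) (w : J -> A) :
  I 0 -> (forall u v, I u -> I v -> I (u - v)) ->
  (forall c u, I u -> I (c *: u)) -> (forall u, I u -> I (endo_fun T u)) ->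
  uniq (map lam s) -> (forall j, endo_fun T (w j) = lam j *: w j) ->
  I (\sum_(j <- s) w j) -> forall j, j \in s -> I (w j).
Proof.
move=> I0 IB IZ IT; elim: s w => // j0 s IHs w /= /andP[j0s s_uniq] Tw.
rewrite big_cons => Iw.
have Is j : j \in s -> I (w j).
  move=> js; have : I ((lam j - lam j0) *: w j).
    (* The rescaled vectors are again eigenvectors for the same [lam]. *)
    apply: (IHs (fun j => (lam j - lam j0) *: w j)) js => // [j'|].
      by rewrite linearZ /= Tw !scalerA mulrC.
    have := IB _ _ (IT _ Iw) (IZ (lam j0) _ Iw).
    rewrite linearD linear_sum /= Tw scalerDr opprD addrACA subrr add0r.
    rewrite scaler_sumr -sumrB; congr I; apply: eq_bigr => j' _.
    by rewrite Tw scalerBl.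
  have lam_j : lam j - lam j0 != 0.
    by rewrite subr_eq0; apply: contraNneq j0s => <-; apply: map_f.
  by move=> /(IZ (lam j - lam j0)^-1); rewrite scalerA mulVf // scale1r.
have Isum : I (\sum_(j <- s) w j).
  rewrite big_seq; apply: (big_ind I) => // u v Iu Iv.
  by rewrite -[v]opprK; apply: (IB) => //; rewrite -sub0r; apply: IB.
move=> j; rewrite inE => /predU1P[->|]; last exact: Is.
by rewrite -[w j0](addrK (\sum_(j <- s) w j)); apply: IB.
Qed.

Lemma horner_alg_dilate (k : fieldType) (A B : algType k)
    (f : {lrmorphism A -> B}) (u : A) (v : B) (r : k) p :
  f u = r *: v -> f (horner_alg u p) = horner_alg v (dilate r p).
Proof.
move=> fu; rewrite /dilate; elim/poly_ind: p => [|p c IH].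
  by rewrite comp_poly0 !rmorph0.
rewrite comp_poly_MXaddC !rmorphD !rmorphM /= IH !horner_algC !horner_algX.
by rewrite rmorph_alg fu linearZ /= horner_algX mulr_algl.
Qed.

(** * Quantum generalized Weyl algebras over Laurent polynomials *)

Section LaurentGwa.
Variables (k : fieldType) (D : comUnitAlgType k) (h : D).
Hypothesis laurent_D : is_laurent h.
Variables (q : k) (q_neq0 : q != 0) (sigma sigmaV : {lrmorphism D -> D}).
Hypotheses (sigmaK : cancel sigma sigmaV) (sigmaVK : cancel sigmaV sigma).
Hypothesis sigma_h : sigma h = q *: h.
Variables (N : nat) (N_gt0 : (0 < N)%N) (c : 'I_N -> k).
Hypothesis c_neq0 : forall i, c i != 0.
Variables (a : {poly k}) (a_def : a = \prod_(i < N) ('X - (c i)%:P)).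
Variables (R : algType k) (iota : {lrmorphism D -> R}) (x y : R).
Hypothesis gwa_R : is_gwa sigma sigmaV (horner_alg h a) iota x y.

Local Notation ev := (horner_alg h).
Local Notation E p := (iota (horner_alg h p)).

Let iota_inj : injective iota := gwa_iota_inj sigmaK sigmaVK gwa_R.

Let sigmaV_h : sigmaV h = q^-1 *: h.
Proof.
apply: (can_inj sigmaK); rewrite sigmaVK linearZ /= sigma_h scalerA.
by rewrite mulVf ?scale1r.
Qed.

Let sigma_ev p : sigma (ev p) = ev (dilate q p).
Proof. exact: horner_alg_dilate. Qed.

Let sigmaV_ev p : sigmaV (ev p) = ev (dilate q^-1 p).
Proof. exact: horner_alg_dilate. Qed.

(** Clearing the denominators, which are units, reduces this to k[X], where evaluation at [h] is
    injective. *)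
Lemma laurent_integral (d e : D) : d * e = 0 -> d = 0 \/ e = 0.
Proof.
have [r [p ->]] := laurent_gen laurent_D d.
have [s [p' ->]] := laurent_gen laurent_D e.
have hU i : h ^+ i \is a GRing.unit by rewrite unitrX ?(laurent_unit laurent_D).
rewrite mulrACA -rmorphM /= => /(congr1 (fun d => h ^+ s * h ^+ r * d)).
rewrite mulr0 !mulrA -[h ^+ s * h ^+ r * _]mulrA divrr // mulr1 divrr // mul1r.
move=> pp'; have /eqP : p * p' = 0.
  by apply: (laurent_inj laurent_D); rewrite pp' rmorph0.
by rewrite mulf_eq0 => /orP[] /eqP ->; [left | right]; rewrite rmorph0 mulr0.
Qed.

(** * The fixed ring of an automorphism that scales [h], [x] and [y] *)

Section Fixed.
Variables (theta : {lrmorphism R -> R}) (gamma mu : k).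
Hypothesis theta_h : theta (iota h) = gamma *: iota h.
Hypotheses (theta_x : theta x = mu^-1 *: x) (theta_y : theta y = mu *: y).
Variables n m : nat.
Hypotheses (ord_gamma : n.-primitive_root gamma).
Hypotheses (m_gt0 : (0 < m)%N) (mu_m : mu ^+ m = 1).
Hypothesis a_gamma : dilate gamma a = a.

Local Notation S := (fixed theta).

Let n_gt0 : (0 < n)%N := prim_order_gt0 ord_gamma.

Let theta_E p : theta (E p) = E (dilate gamma p).
Proof.
pose f : {lrmorphism D -> R} := theta \o iota.
rewrite -[LHS]/(f (ev p)) (horner_alg_dilate (v := iota h) (r := gamma)) //.
by rewrite (horner_alg_dilate (v := iota h) (r := 1)) ?scale1r ?dilate1.
Qed.

Let fixedP u : reflect (theta u = u) (u \in S).
Proof. exact: eqP. Qed.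

Let fixedZ r u : u \in S -> r *: u \in S.
Proof. by move=> /fixedP Su; apply/fixedP; rewrite linearZ /= Su. Qed.

Let E_S p : E (p \Po 'X^n) \in S.
Proof.
apply/fixedP; rewrite theta_E dilate_comp_Xn (prim_expr_order ord_gamma).
by rewrite dilate1.
Qed.

Lemma not_simple_fixed i j l :
  (0 < l)%N -> c i = q ^+ l * c j -> ~ simple_sub S.
Proof.
(* From here on [l] is one less than the given exponent, so [f] has the factors [g 0], ..., [g l],
   and [g l] has the root [c j]. *)
case: l => // l _ cij simpleS.
pose b := 'X - (c i)%:P; pose b' := \prod_(t < N | t != i) ('X - (c t)%:P).
have bb' : b * b' = a by rewrite a_def [RHS](bigD1 i).
have ev_bb' : ev b * ev b' = ev a by rewrite -rmorphM bb'.
pose r s := c i / q ^+ s.+1; pose g s := 'X - (r s)%:P.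
have r_neq0 s : r s != 0 by rewrite mulf_neq0 ?invr_eq0 ?expf_neq0.
pose f := \prod_(s < l.+1) g s.
have [phi [phi_d phi_x phi_y]] := gwa_rep sigmaK sigmaVK gwa_R ev_bb'.
(* Up to scalars, dilation by [q] turns [b] into [g 0] and [g s] into [g s.+1], so the product
   becomes [f * g l.+1]. *)
have [p fx] : exists p, dilate q (b * f) = f * p.
  have gS s : dilate q (g s) = q *: g s.+1.
    by rewrite dilate_XsubC // /g /r [q ^+ s.+2]exprSr invfM mulrA.
  exists (q *: (q ^+ l.+1 *: g l.+1)).
  rewrite rmorphM rmorph_prod /=; under eq_bigr do rewrite gS.
  rewrite scaler_prod prodr_const card_ord dilate_XsubC //.
  rewrite -scalerAl -scalerAr -scalerAr -scalerAr; congr (_ *: (_ *: _)).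
  transitivity (\prod_(s < l.+2) g s); first by rewrite big_ord_recl.
  by rewrite big_ord_recr.
(* Dilation by the inverse of [q] turns [g 0] into [b] and lowers the other indices. This loses the
   factor [g l], which is recovered from [b' * b = a], as [c j] is a root of [a]. *)
have [p' fy] : exists p', b' * dilate q^-1 f = f * p'.
  have gS s : dilate q^-1 (g s.+1) = q^-1 *: g s.
    rewrite dilate_XsubC ?invr_eq0 // /g /r [q ^+ s.+2]exprSr invfM invrK mulrA.
    by rewrite divfK.
  have g0 : dilate q^-1 (g 0%N) = q^-1 *: b.
    by rewrite dilate_XsubC ?invr_eq0 // /r invrK expr1 divfK.
  have gl : g l = 'X - (c j)%:P.
    by rewrite /g /r cij mulrAC divff ?mul1r ?expf_neq0.
  have [a' aE] : exists a', b' * b = g l * a'.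
    by rewrite mulrC bb' a_def (bigD1 j) //= gl; eexists.
  exists (q^-1 *: (q^-1 ^+ l *: a')).
  rewrite {1}/f rmorph_prod big_ord_recl /= g0.
  under eq_bigr do rewrite /= /bump add1n gS.
  rewrite scaler_prod prodr_const card_ord.
  rewrite -scalerAl -!scalerAr; congr (_ *: (_ *: _)).
  by rewrite mulrA aE mulrAC /f [in RHS]big_ord_recr /= [_ * g l]mulrC.
have stable u : forall d, exists e,
    endo_fun (phi u) (ev f * d) = ev f * e.
  move: u; apply: (gwa_ind gwa_R) => [d e||| u v Pu Pv d|u v Pu Pv d].
  - by exists (d * e); rewrite phi_d mulrCA.
  - move=> d; exists (ev p * sigma d); rewrite phi_x.
    have -> : ev b * (ev f * d) = ev (b * f) * d by rewrite rmorphM mulrA.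
    have -> : sigma (ev (b * f) * d) = sigma (ev (b * f)) * sigma d.
      exact: rmorphM.
    by rewrite sigma_ev fx rmorphM mulrA.
  - move=> d; exists (ev p' * sigmaV d); rewrite phi_y.
    have -> : sigmaV (ev f * d) = sigmaV (ev f) * sigmaV d by exact: rmorphM.
    by rewrite sigmaV_ev [LHS]mulrA -(rmorphM ev) fy rmorphM -mulrA.
  - have [[e ue] [e' ve']] := (Pu d, Pv d); exists (e + e').
    by rewrite rmorphD /= ue ve' mulrDr.
  - have [e ve] := Pv d; have [e' ue'] := Pu e; exists e'.
    by rewrite rmorphM /= ve ue'.
(* The elements of [S] that send all of [D] into [f D]; stability of [f D] makes this absorb left
   factors as well. *)
pose I u := u \in S /\ forall d, exists e, endo_fun (phi u) d = ev f * e.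
have I_ideal : sub_ideal S I.
  split=> [u []//||u v [Su Iu] [Sv Iv]|u v Su [Sv Iv]|v u Sv [Su Iu]].
  + split; first exact: rpred0.
    by move=> d; exists 0; rewrite rmorph0 mulr0.
  + split=> [|d]; first exact: rpredB.
    have [[e ue] [e' ve']] := (Iu d, Iv d); exists (e - e').
    by rewrite rmorphB /= ue ve' mulrBr.
  + split=> [|d]; first exact: rpredM.
    by have [e ve] := Iv d; rewrite rmorphM /= ve; apply: stable.
  + split=> [|d]; first exact: rpredM.
    by rewrite rmorphM /=; apply: Iu.
have [I_0|I_1] := simpleS I I_ideal.
(* Each [g s] divides X^n - r_s^n, so [f] divides the monic polynomial P(X^n), whose value at [h] is
   a nonzero element of [I]. *)
- pose P := \prod_(s < l.+1) ('X - (r s ^+ n)%:P).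
  have PE : P \Po 'X^n = \prod_(s < l.+1) ('X^n - (r s ^+ n)%:P).
    rewrite rmorph_prod; apply: eq_bigr => s _.
    by rewrite rmorphB /= comp_polyX comp_polyC.
  have /dvdpP [p'' Pf] : f %| P \Po 'X^n.
    rewrite PE; apply: (big_ind2 (fun u v => u %| v)) => // [u v u' v'|s _].
      exact: dvdp_mul.
    by rewrite dvdp_XsubCl rootE !hornerE subrr.
  have /I_0/eqP : I (E (P \Po 'X^n)).
    split; first exact: E_S.
    by move=> d; exists (ev p'' * d); rewrite phi_d Pf rmorphM mulrAC mulrC.
  rewrite -(rmorph0 iota) (inj_eq iota_inj) -(rmorph0 ev).
  rewrite (inj_eq (laurent_inj laurent_D)) PE.
  by rewrite (negPf (monic_neq0 (monic_prod _ _))) // => s _; apply: monicXnsubC.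
(* If 1 were in [I], then [f] would be invertible in [D] and so divide a power of X, which fails at
   its nonzero root [r 0]. *)
- have [_ /(_ 1) [e]] := I_1 1 (rpred1 _).
  rewrite rmorph1 /=; have [t [p'' ->]] := laurent_gen laurent_D e.
  rewrite mulrCA -rmorphM /= => /(congr1 (fun d => h ^+ t * d)).
  rewrite mulr1 mulVKr ?unitrX ?(laurent_unit laurent_D) //.
  rewrite -[h](horner_algX) -rmorphXn horner_algX => /(laurent_inj laurent_D).
  move=> /(congr1 (fun p => p.[r 0%N])) /eqP.
  rewrite hornerXn hornerM /f big_ord_recl hornerM /g hornerXsubC subrr !mul0r.
  by rewrite expf_eq0 (negPf (r_neq0 _)) andbF.
Qed.

(** * One direction of the grading: [z], [z'], [tau] stand for [x], [y], [sigma] or for [y], [x],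
    [sigmaV] *)

Section Half.
Variables (z z' : R) (tau : {lrmorphism D -> D}) (t : k) (b : {poly k}).
Hypotheses (z_iota : forall d, z * iota d = iota (tau d) * z).
Hypotheses (t_neq0 : t != 0) (tau_inj : injective tau) (tau_h : tau h = t *: h).
Hypotheses (zz' : z * z' = E b) (b_neq0 : b != 0).
Hypotheses (z_m : z ^+ m \in S) (z'_m : z' ^+ m \in S).

Let tau_iter j d : z ^+ j * iota d = iota (iter j tau d) * z ^+ j.
Proof.
elim: j => [|j IH]; first by rewrite !expr0 mulr1 mul1r.
by rewrite exprS -mulrA IH mulrA z_iota -mulrA -exprS.
Qed.

Let tau_iter_neq0 j d : d != 0 -> iter j tau d != 0.
Proof.
by move=> d0; elim: j => //= j; rewrite -(inj_eq tau_inj) rmorph0.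
Qed.

Lemma expr_mulE j p : z ^+ j * E p = E (dilate (t ^+ j) p) * z ^+ j.
Proof.
rewrite tau_iter; congr (iota _ * _); elim: j => [|j IH] /=.
  by rewrite expr0 dilate1.
by rewrite IH (horner_alg_dilate _ tau_h) dilateM exprS.
Qed.

Lemma expr_mul_expr j :
  z ^+ j * z' ^+ j = E (\prod_(s < j) dilate (t ^+ s) b).
Proof.
elim: j => [|j IH]; first by rewrite big_ord0 !rmorph1 mulr1.
rewrite exprSr exprS mulrA -[_ * z * z']mulrA zz' expr_mulE -mulrA IH.
by rewrite -!rmorphM big_ord_recr mulrC.
Qed.

(** Moving [z ^+ j] past h^n costs the factor t^(nj). The power h^n is used rather than [h] because
    it lies in [S]. *)
Lemma conj_expr j d :
  iota (h ^- n) * (iota d * z ^+ j) * E 'X^n =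
    (t ^+ n) ^+ j *: (iota d * z ^+ j).
Proof.
rewrite -!mulrA expr_mulE.
have -> : dilate (t ^+ j) 'X^n = (t ^+ n) ^+ j *: 'X^n.
  by rewrite /dilate comp_Xn_poly exprZn exprAC.
rewrite linearZ /= mulr_algl linearZ /= -scalerAl -!scalerAr; congr (_ *: _).
rewrite !mulrA -!rmorphM mulrAC rmorphXn /= horner_algX mulVr ?mul1r //.
by rewrite unitrX ?(laurent_unit laurent_D).
Qed.

(** The [m]-th power of the element has degree mj, and multiplying by [z' ^+ m], an element of [S],
    [j] times brings it to degree 0. The result is nonzero because [D] is a domain and [tau] is
    injective. *)
Lemma homogeneous_ideal I d j : sub_ideal S I ->
  d != 0 -> I (iota d * z ^+ j) -> exists2 e, e != 0 & I (iota e).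
Proof.
move=> [IS I0 IB IMl IMr] d0 Iw; have Sw := IS _ Iw.
have w_expr i : exists2 e, e != 0 &
    (iota d * z ^+ j) ^+ i = iota e * z ^+ (j * i).
  elim: i => [|i [e e0 we]].
    by exists 1; rewrite ?oner_eq0 // muln0 !expr0 rmorph1 mulr1.
  exists (d * iter j tau e).
    apply/eqP => /laurent_integral [] /eqP; rewrite ?(negPf d0) //.
    by rewrite (negPf (tau_iter_neq0 _ e0)).
  rewrite exprS we mulrA -[iota d * _ * _]mulrA tau_iter -!mulrA mulnS exprD.
  by rewrite rmorphM !mulrA.
have Iwm i : (0 < i)%N -> I ((iota d * z ^+ j) ^+ i).
  elim: i => [//|[|i] IH _]; first by rewrite expr1.
  by rewrite exprSr; apply: IMr => //; apply: IH.
have [e e0 we] := w_expr m.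
exists (e * ev (\prod_(s < m * j) dilate (t ^+ s) b)).
  apply/eqP => /laurent_integral [] /eqP; rewrite ?(negPf e0) //.
  rewrite -(rmorph0 ev) (inj_eq (laurent_inj laurent_D)) => /prodf_eq0 [s _].
  by rewrite dilate_eq0 ?expf_neq0 // (negPf b_neq0).
rewrite rmorphM /= -expr_mul_expr {1}[(m * j)%N]mulnC mulrA -we exprM.
by apply: IMr; [apply: rpredX | apply: Iwm].
Qed.

End Half.

Let hVn_S : iota (h ^- n) \in S.
Proof.
have hX : E 'X^n * iota (h ^- n) = 1.
  rewrite -rmorphM /= rmorphXn /= horner_algX mulrV ?rmorph1 //.
  by rewrite unitrX ?(laurent_unit laurent_D).
have /fixedP ES : E 'X^n \in S by rewrite -['X^n]comp_polyX E_S.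
have Xh : iota (h ^- n) * E 'X^n = 1 by rewrite -rmorphM mulrC rmorphM.
apply/fixedP; rewrite -[LHS]mulr1 -hX mulrA -{1}ES -rmorphM Xh.
by rewrite rmorph1 mul1r.
Qed.

Let x_m : x ^+ m \in S.
Proof.
by apply/fixedP; rewrite rmorphXn /= theta_x exprZn exprVn mu_m invr1 scale1r.
Qed.

Let y_m : y ^+ m \in S.
Proof. by apply/fixedP; rewrite rmorphXn /= theta_y exprZn mu_m scale1r. Qed.

Let x_iota d : x * iota d = iota (sigma d) * x.
Proof. exact: gwa_xd (gwa_relP gwa_R) d. Qed.

Let y_iota d : y * iota d = iota (sigmaV d) * y.
Proof. exact: gwa_yd (gwa_relP gwa_R) d. Qed.

Let mul_xy : x * y = E (dilate q a).
Proof. by rewrite (gwa_xy (gwa_relP gwa_R)) sigma_ev. Qed.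

Let mul_yx : y * x = E a.
Proof. exact: gwa_yx (gwa_relP gwa_R). Qed.

Let qV_neq0 : q^-1 != 0. Proof. by rewrite invr_eq0. Qed.

Let a_neq0 : a != 0.
Proof.
rewrite a_def; apply/prodf_neq0 => i _.
exact: (monic_neq0 (monicXsubC _)).
Qed.

(** * Simplicity when no two roots differ by a positive power of [q] *)

Section RootsApart.
Hypothesis c_free : forall i j l, (0 < l)%N -> c i <> q ^+ l * c j.

Let q_inf l : (0 < l)%N -> q ^+ l != 1.
Proof.
move=> l0; apply/eqP => ql.
by apply: (c_free (i := Ordinal N_gt0) (j := Ordinal N_gt0) l0); rewrite ql mul1r.
Qed.

Lemma laurent_ideal I u : sub_ideal S I -> I u -> u != 0 ->
  exists2 e, e != 0 & I (iota e).
Proof.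
move=> I_ideal Iu u0; have [IS I0 IB IMl IMr] := I_ideal.
have [p [e uE]] := gwa_span gwa_R u.
(* Integers index the grading: [Negz i] is degree -(i+1), whence the exponent [i.+1]. *)
pose w (j : int) := match j with
  | Posz i => iota p`_i * x ^+ i
  | Negz i => iota e`_i * y ^+ i.+1
  end.
pose lam (j : int) := match j with
  | Posz i => (q ^+ n) ^+ i
  | Negz i => (q^-1 ^+ n) ^+ i.+1
  end.
pose s := [seq Posz i | i <- index_iota 0 (size p)] ++
          [seq Negz i | i <- index_iota 0 (size e)].
have us : u = \sum_(j <- s) w j.
  rewrite big_cat !big_map !big_mkord uE.
  rewrite (horner_coef_wide _ (size_poly _ _)).
  rewrite [X in _ + X * y](horner_coef_wide _ (size_poly _ _)) mulr_suml.
  congr (_ + _); apply: eq_bigr => i _; rewrite coef_map //=.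
  by rewrite exprSr mulrA.
have T_linear : linear (fun v => iota (h ^- n) * v * E 'X^n).
  by move=> r v v'; rewrite mulrDr mulrDl -scalerAr -scalerAl.
have Qn_inf l : (0 < l)%N -> (q ^+ n) ^+ l != 1.
  by move=> l0; rewrite -exprM q_inf // muln_gt0 n_gt0.
have Qn0 : q ^+ n != 0 by rewrite expf_neq0.
have lamE i i' : lam (Posz i) != lam (Negz i').
  apply/eqP => /= /(congr1 (fun r => r * (q ^+ n) ^+ i'.+1)) /eqP.
  rewrite -exprD exprVn -exprMn mulVf // expr1n.
  by apply/negP/Qn_inf; rewrite addnS.
have lam_inj : injective lam.
  case=> [i|i] [i'|i'].
  - by move=> /(expr_inj Qn0 Qn_inf) ->.
  - by move/eqP; rewrite (negPf (lamE _ _)).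
  - by move/esym/eqP; rewrite (negPf (lamE _ _)).
  - rewrite /lam !exprVn => /invr_inj /(expr_inj Qn0 Qn_inf) [->] //.
have s_uniq : uniq (map lam s).
  rewrite map_inj_uniq // cat_uniq !map_inj_uniq ?iota_uniq ?andbT //=.
  - by apply/hasPn => _ /mapP [i _ ->]; apply/mapP => -[].
  - by move=> ? ? [].
  - by move=> ? ? [].
have IZ r v : I v -> I (r *: v).
  move=> Iv; rewrite -mulr_algl; apply: IMl => //.
  by apply: fixedZ; apply: rpred1.
have I_comp := eigen_components (T := Endo T_linear) I0 IB IZ _ s_uniq.
have Iw j : j \in s -> I (w j).
  apply: I_comp; last by rewrite -us.
    by move=> v Iv /=; apply: IMr; [rewrite -['X^n]comp_polyX E_S | apply: IMl].
  case=> i.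
    exact: (conj_expr x_iota sigma_h).
  exact: (conj_expr y_iota sigmaV_h).
have [/allP w0|/allPn [j js wj]] := boolP (all (fun j => w j == 0) s).
  case/eqP: u0; rewrite us big_seq big1 // => j js.
  exact/eqP/w0.
case: j js wj => i /Iw /= Iwi wi.
  apply: (homogeneous_ideal x_iota q_neq0 (can_inj sigmaK) sigma_h mul_xy
    _ y_m I_ideal _ Iwi); first by rewrite dilate_eq0.
  by apply: contraNneq wi => ->; rewrite rmorph0 mul0r.
apply: (homogeneous_ideal y_iota qV_neq0 (can_inj sigmaVK) sigmaV_h mul_yx
  a_neq0 x_m I_ideal _ Iwi).
by apply: contraNneq wi => ->; rewrite rmorph0 mul0r.
Qed.

Lemma polynomial_ideal I e : sub_ideal S I -> I (iota e) -> e != 0 ->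
  exists2 P : {poly k}, P.[0] != 0 & I (E (P \Po 'X^n)).
Proof.
move=> [IS I0 IB IMl IMr] Ie e0; have [r [p eE]] := laurent_gen laurent_D e.
have p0 : p != 0 by apply: contraNneq e0 => p0; rewrite eE p0 rmorph0 mulr0.
(* The denominator h^r is cleared by h^(nr), which lies in [S] while h^r need not; this leaves
   h^(nr-r). *)
pose p1 := 'X^(n * r - r) * p.
have Ip1 : I (E p1).
  have -> : E p1 = E ('X^r \Po 'X^n) * iota e.
    rewrite eE -rmorphM; congr (iota _); rewrite comp_Xn_poly -exprM.
    rewrite -(subnK (leq_pmull r n_gt0)) exprD /p1 !rmorphM !rmorphXn /=.
    rewrite !horner_algX -!mulrA; congr (_ * _); rewrite mulVKr //.
    by rewrite unitrX ?(laurent_unit laurent_D).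
  by apply: IMl => //; apply: E_S.
have [q1 p1E] : exists q1, p1 = q1 \Po 'X^n.
  apply: (comp_Xn_of_dilate ord_gamma).
  apply: (laurent_inj laurent_D); apply: iota_inj.
  by rewrite -theta_E; apply/fixedP/IS.
have q1_neq0 : q1 != 0.
  have : p1 != 0 by rewrite mulf_neq0 // monic_neq0 // monicXn.
  by apply: contraNneq => q10; rewrite p1E q10 comp_poly0.
(* Splitting off the power of X in [q1] makes P(0) nonzero; in the ideal it is cancelled by a power
   of h^(-n), an element of [S]. *)
have [t [P /implyP/(_ q1_neq0) P0 q1E]] := multiplicity_XsubC q1 0.
exists P; first exact: P0.
have -> : E (P \Po 'X^n) = E p1 * iota (h ^- n) ^+ t.
  rewrite p1E q1E subr0 comp_polyM comp_Xn_poly -rmorphXn -rmorphM; congr (iota _).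
  rewrite rmorphM !rmorphXn /= horner_algX -mulrA exprVn mulrV ?mulr1 //.
  by rewrite !unitrX ?(laurent_unit laurent_D).
by apply: IMr => //; apply: rpredX.
Qed.

Lemma simple_fixed : simple_sub S.
Proof.
move=> I I_ideal; have [IS I0 IB IMl IMr] := I_ideal.
have [[u [Iu u0]]|I_0] := pselect (exists u, I u /\ u != 0); last first.
  left=> u Iu; have [//|u0] := eqVneq u 0.
  by case: I_0; exists u.
right; have [e e0 Ie] := laurent_ideal I_ideal Iu u0.
have [P P0 IP] := polynomial_ideal I_ideal Ie e0.
have [A aA] := comp_Xn_of_dilate ord_gamma a_gamma.
(* [J] is an ideal of k[X], and the goal becomes that it contains 1. *)
pose J p := I (E (p \Po 'X^n)).
have JD p p' : J p -> J p' -> J (p + p').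
  move=> Jp Jp'; rewrite /J comp_polyD !rmorphD /= -[X in _ + X]opprK.
  by apply: (IB) => //; rewrite -sub0r; apply: IB.
have JM p p' : J p' -> J (p * p').
  move=> Jp'; rewrite /J comp_polyM !rmorphM.
  by apply: IMl; [apply: E_S | apply: Jp'].
have J_eqp p p' : p %= p' -> J p -> J p'.
  rewrite eqp_sym => /eqpf_eq [r _ ->] Jp.
  by rewrite -mul_polyC; apply: JM.
have J_gcd p p' : J p -> J p' -> J (gcdp p p').
  move=> Jp Jp'; have [v vE] := Bezoutp p p'.
  by apply: (J_eqp _ _ vE); apply: JD; apply: JM.
have Qm0 : q ^+ (n * m) != 0 by rewrite expf_neq0.
have Qm_inf l : (0 < l)%N -> (q ^+ (n * m)) ^+ l != 1.
  by move=> l0; rewrite -exprM q_inf // !muln_gt0 n_gt0 m_gt0.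
(* This fixes the exponent M = ml: x^M and y^M lie in [S], and commuting x^M past P(h^n) rescales
   the argument of [P] by q^(nM). *)
have [l Pl] := coprimep_dilate_expr P0 Qm0 Qm_inf.
have J_conj (z z' : R) (t : k) (b : {poly k}) (tau : {lrmorphism D -> D}) :
    (forall d, z * iota d = iota (tau d) * z) -> tau h = t *: h ->
    z * z' = E (b \Po 'X^n) ->
    z ^+ m \in S -> z' ^+ m \in S ->
    J (dilate ((t ^+ (n * m)) ^+ l) P *
       \prod_(s < m * l) dilate ((t ^+ s) ^+ n) b).
  move=> z_iota tau_h zz' zm z'm; rewrite /J comp_polyM !rmorphM /=.
  have -> : t ^+ (n * m) ^+ l = (t ^+ (m * l)) ^+ n by rewrite -!exprM -mulnA mulnC.
  rewrite -dilate_comp_Xn.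
  have -> : (\prod_(s < m * l) dilate ((t ^+ s) ^+ n) b) \Po 'X^n =
      \prod_(s < m * l) dilate (t ^+ s) (b \Po 'X^n).
    by rewrite rmorph_prod; apply: eq_bigr => s _; rewrite dilate_comp_Xn.
  rewrite -(expr_mul_expr z_iota tau_h zz') mulrA -(expr_mulE z_iota tau_h).
  rewrite !exprM; apply: IMr; first exact: rpredX.
  by apply: IMl; first exact: rpredX.
have zz'x : x * y = E (dilate (q ^+ n) A \Po 'X^n).
  by rewrite mul_xy aA dilate_comp_Xn.
have zz'y : y * x = E (A \Po 'X^n) by rewrite mul_yx aA.
have J1 := J_conj _ _ _ _ _ x_iota sigma_h zz'x x_m y_m.
have J2 := J_conj _ _ _ _ _ y_iota sigmaV_h zz'y y_m x_m.
set Q := (q ^+ (n * m)) ^+ l in J1 Pl.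
set QV := (q^-1 ^+ (n * m)) ^+ l in J2.
(* Rescaling both polynomials in [Pl] by [QV], the inverse of [Q], gives the coprimality for the
   opposite direction. *)
have PV : coprimep P (dilate QV P).
  rewrite coprimep_sym -{2}[P](dilate1) -(_ : QV * Q = 1).
    by rewrite -dilateM coprimep_dilate.
  by rewrite /Q /QV !exprVn mulVf // expf_neq0.
set A1 := \prod_(s < _) _ in J1; set A2 := \prod_(s < _) _ in J2.
(* After substituting X^n, the factors of [A1] have the roots c_i q^(-s-1) and those of [A2] the
   roots c_j q^(s'). A common one gives c_i = q^(s+s'+1) c_j. *)
have A12 : coprimep A1 A2.
  apply: coprimep_prodl => s; apply: coprimep_prodr => s'.
  apply: (coprimep_comp_Xn n_gt0); rewrite dilateM -exprMn -!dilate_comp_Xn -aA.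
  rewrite a_def !rmorph_prod; apply: coprimep_prodl => i.
  apply: coprimep_prodr => j; rewrite /= !dilate_XsubC ?mulf_neq0 ?expf_neq0 //.
  rewrite coprimepZl ?coprimepZr ?mulf_neq0 ?expf_neq0 //.
  rewrite coprimep_XsubC rootE hornerXsubC subr_eq0.
  apply/eqP => /(congr1 (fun r => q ^+ s.+1 * r)).
  rewrite -exprSr exprVn invrK [RHS]mulrC divfK ?expf_neq0 // mulrCA mulrC.
  by rewrite -exprD => /esym; apply: c_free; rewrite addSn.
(* A common divisor of the three elements of [J] divides [P], so it is coprime to both rescalings of
   [P] and must divide [A1] and [A2]. *)
have J_1 : J 1.
  apply: (J_eqp _ _ _ (J_gcd _ _ IP (J_gcd _ _ J1 J2))); rewrite gcdp_eqp1.
  apply/coprimepP => d dP; rewrite dvdp_gcd => /andP [d1 d2].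
  apply: (coprimepP _ _ A12).
    by rewrite -(Gauss_dvdpr _ (coprimep_dvdr dP Pl)).
  by rewrite -(Gauss_dvdpr _ (coprimep_dvdr dP PV)).
move=> u' Su'; rewrite -[u']mulr1; apply: IMl => //.
by move: J_1; rewrite /J comp_polyC !rmorph1.
Qed.

End RootsApart.

Lemma simple_fixedP :
  simple_sub S <-> forall i j l, (0 < l)%N -> c i <> q ^+ l * c j.
Proof.
split=> [simpleS i j l l0 cij|]; last exact: simple_fixed.
exact: not_simple_fixed l0 cij simpleS.
Qed.

End Fixed.
End LaurentGwa.

(** * Application to [eta] and to the identity *)

Lemma dilate_exponent_gcd (k : fieldType) (a : {poly k}) i0 n gamma :
  n.-primitive_root gamma -> a`_i0 != 0 -> (n %| i0)%N ->
  gamma ^+ exponent_gcd a = 1 -> dilate gamma a = a.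
Proof.
move=> gamma_n ai0 n_i0 /eqP; rewrite -(prim_order_dvd gamma_n) => n_g.
apply/polyP => i; rewrite coef_dilate; have [->|ai] := eqVneq a`_i 0.
  by rewrite mulr0.
have lt_size j : a`_j != 0 -> (j < size a)%N.
  by apply: contraR; rewrite -leqNgt => /(nth_default 0) ->.
(* [n] divides this gcd, hence i - i0, and [n] divides [i0]; so [n] divides every exponent in the
   support of [a]. *)
have g_i : (exponent_gcd a %| `|i%:Z - i0%:Z|)%N.
  apply: (@biggcdn_inf _ (Ordinal (lt_size i ai))) => //.
  by apply: (@biggcdn_inf _ (Ordinal (lt_size i0 ai0))); rewrite //= mulf_neq0.
have n_i : (n %| i)%N.
  suff: (n%:Z %| i%:Z)%Z by [].
  rewrite -[i%:Z](subrK i0%:Z); apply: rpredD; last exact: n_i0.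
  exact: dvdn_trans n_g g_i.
by move: n_i; rewrite (prim_order_dvd gamma_n) => /eqP ->; rewrite mul1r.
Qed.

Theorem proposition4p18
  (k : fieldType)
  (D : comUnitAlgType k) (h : D) (laurent_D : is_laurent h)
  (q : k) (q_neq0 : q != 0) (q_neq1 : q != 1)
  (sigma sigmaV : {lrmorphism D -> D})
  (sigmaK : cancel sigma sigmaV) (sigmaVK : cancel sigmaV sigma)
  (sigma_h : sigma h = q *: h)
  (N : nat) (N_gt0 : (0 < N)%N)
  (c : 'I_N -> k) (c_neq0 : forall i, c i != 0)
  (a : {poly k}) (a_def : a = \prod_(i < N) ('X - (c i)%:P))
  (R : algType k) (iota : {lrmorphism D -> R}) (x y : R)
  (gwa_R : is_gwa sigma sigmaV (horner_alg h a) iota x y)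
  (i0 : nat) (i0_I : a`_i0 != 0)
  (gamma mu : k) (gamma_neq0 : gamma != 0) (mu_neq0 : mu != 0)
  (n m : nat)
  (ord_gamma : n.-primitive_root gamma) (ord_mu : m.-primitive_root mu)
  (n_dvd_i0 : (n %| i0)%N) (coprime_nm : coprime n m)
  (eta : {lrmorphism R -> R})
  (eta_def : is_eta a (iota h) x y i0 gamma mu eta) :
  simple_ring (fixed_ring eta) <-> simple_ring R.
Proof.
have [gamma_g _ eta_h eta_y eta_x] := eta_def.
(* Thus [eta] scales [x] by exactly the inverse of [mu], as the criterion for the fixed ring
   expects. *)
have gamma_i0 : gamma ^+ i0 = 1.
  by apply/eqP; rewrite -(prim_order_dvd ord_gamma).
have m_gt0 := prim_order_gt0 ord_mu.
have a_gamma := dilate_exponent_gcd ord_gamma i0_I n_dvd_i0 gamma_g.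
rewrite gamma_i0 mulr1 in eta_x.
have S_P := simple_fixedP laurent_D q_neq0 sigmaK sigmaVK sigma_h N_gt0 c_neq0
  a_def gwa_R eta_h eta_x eta_y ord_gamma m_gt0 (prim_expr_order ord_mu) a_gamma.
(* [R] is the case gamma = mu = 1 and n = m = 1; the condition on the roots is the same. *)
have one_root : 1.-primitive_root (1 : k).
  by apply/andP; split=> //; apply/forallP => i; rewrite ord1 unity_rootE expr1 !eqxx.
pose f : {lrmorphism R -> R} := idfun.
have f_h : f (iota h) = 1 *: iota h by rewrite scale1r.
have f_x : f x = 1^-1 *: x by rewrite invr1 scale1r.
have f_y : f y = 1 *: y by rewrite scale1r.
have R_P := simple_fixedP laurent_D q_neq0 sigmaK sigmaVK sigma_h N_gt0 c_neq0
  a_def gwa_R f_h f_x f_y one_root (ltn0Sn 0) (expr1n k 1) (dilate1 a).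
exact: iff_trans (iff_trans (simple_fixed_ring eta) S_P)
  (iff_sym (iff_trans (simple_ring_fixed_id R) R_P)).
Qed.
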